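(* Let $A\in\mathbb{R}^{n\times n}$ be a matrix diagonalizable over $\mathbb{C}$. Suppose that all eigenvalues of $A$ are algebraic integers having the same minimal polynomial $f$ (over $\mathbb{Q}$), of degree $d$. Denote $M:=\max\{m_A(\beta):\beta\text{ a root of }f\}\ (\geq 1)$ and $m:=\min\{m_A(\beta):\beta\text{ a root of }f\}\ (\geq 0)$. Let $\Lambda=(\mathcal{L}\subset\mathbb{R}^s,\mathbb{R}^n)$ be a generic cut-and-project scheme with self-similarity $A$ such that the dimension $s$ of the lattice is as small as possible. Then $s=Md$ if $m<M$, and $s=(M+1)d$ otherwise.
   Context: For a matrix $T$ and $\lambda\in\mathbb{C}$, $m_T(\lambda)$ denotes the algebraic multiplicity of $\lambda$ as an eigenvalue of $T$ ($m_T(\lambda)=0$ if $\lambda$ is not an eigenvalue). A lattice $\mathcal{L}\subset\mathbb{R}^s$ is a set $\{L\mathbf{r}:\mathbf{r}\in\mathbb{Z}^s\}$ for a non-singular $L\in\mathbb{R}^{s\times s}$, called a matrix associated to $\mathcal{L}$. For $1\le n<s$, the cut-and-project scheme $\Lambda=(\mathcal{L}\subset\mathbb{R}^s,\mathbb{R}^n)$ consists of $\mathcal{L}$ with projections $\pi_\parallel(\mathbf{x})=(x_1,\dots,x_n)^\top$, $\pi_\perp(\mathbf{x})=(x_{n+1},\dots,x_s)^\top$. It is non-degenerate if $\pi_\parallel|_{\mathcal{L}}$ is injective, aperiodic if $\pi_\perp|_{\mathcal{L}}$ is injective, irreducible if $\pi_\perp(\mathcal{L})$ is dense in $\mathbb{R}^{s-n}$,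 and generic if all three hold. A matrix $A\in\mathbb{R}^{n\times n}$ is a self-similarity of a generic scheme $\Lambda$ with associated matrix $L$ if $A\pi_\parallel(\mathcal{L})\subset\pi_\parallel(\mathcal{L})$ and there exist $C\in\mathbb{Z}^{s\times s}$, $B\in\mathbb{R}^{(s-n)\times(s-n)}$ with $\begin{pmatrix}A&O\\O&B\end{pmatrix}L=LC$. *)

(* Defs.v *)
From HB Require Import structures.
From mathcomp Require Import all_boot all_order all_algebra.
From mathcomp Require Import reals complex.
Set Implicit Arguments. Unset Strict Implicit. Unset Printing Implicit Defensive.
Import Order.TTheory GRing.Theory Num.Theory.
Local Open Scope ring_scope.

Section Defs.
Variable R : realType.
Local Notation C := (complex R).

Definition cmx n (A : 'M[R]_n) : 'M[C]_n := map_mx (fun x : R => (x%:C)%C) A.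

Definition alg_mult n (A : 'M[R]_n) (l : C) : nat := mup l (char_poly (cmx A)).

Definition algebraic_integer (z : C) : Prop :=
  exists p : {poly int}, p \is monic /\ root (map_poly (fun x : int => x%:~R) p) z.

Definition minpoly_Q (f : {poly rat}) (z : C) : Prop :=
  [/\ f \is monic, root (map_poly (fun q : rat => ratr q) f) z
    & forall g : {poly rat}, g != 0 -> root (map_poly (fun q : rat => ratr q) g) z ->
        (size f <= size g)%N].

(* Cut-and-project scheme in R^s with s = n + k, physical space R^n.
   L is the associated matrix; lattice points are L *m r, r in Z^s.
   pi_par = first n coordinates (usubmx), pi_perp = last k coordinates (dsubmx). *)
Definition in_lattice n k (L : 'M[R]_(n + k)) (x : 'cV[R]_(n + k)) : Prop :=
  exists r : 'cV[int]_(n + k), x = L *m map_mx (fun z : int => z%:~R) r.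

Definition pi_par n k (x : 'cV[R]_(n + k)) : 'cV[R]_n := usubmx x.
Definition pi_perp n k (x : 'cV[R]_(n + k)) : 'cV[R]_k := dsubmx x.

Definition nondegenerate n k (L : 'M[R]_(n + k)) : Prop :=
  forall x y, in_lattice L x -> in_lattice L y -> pi_par x = pi_par y -> x = y.

Definition aperiodic n k (L : 'M[R]_(n + k)) : Prop :=
  forall x y, in_lattice L x -> in_lattice L y -> pi_perp x = pi_perp y -> x = y.

Definition irreducible_cps n k (L : 'M[R]_(n + k)) : Prop :=
  forall (y : 'cV[R]_k) (e : R), 0 < e ->
    exists x, in_lattice L x /\ forall i, `|pi_perp x i 0 - y i 0| < e.

Definition generic_cps n k (L : 'M[R]_(n + k)) : Prop :=
  [/\ (0 < n)%N, (0 < k)%N, L \in unitmx,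
      nondegenerate L & aperiodic L] /\ irreducible_cps L.

Definition self_similarity n k (L : 'M[R]_(n + k)) (A : 'M[R]_n) : Prop :=
  (forall x, in_lattice L x -> exists y, in_lattice L y /\ A *m pi_par x = pi_par y)
  /\ exists (Cm : 'M[int]_(n + k)) (B : 'M[R]_k),
       block_mx A 0 0 B *m L = L *m map_mx (fun z : int => z%:~R) Cm.

Definition generic_cps_with_selfsim n k (A : 'M[R]_n) (L : 'M[R]_(n + k)) : Prop :=
  generic_cps L /\ self_similarity L A.

End Defs.

(* Main.v *)
Require Import Defs.
From HB Require Import structures.
From mathcomp Require Import all_boot all_order all_algebra separable.
From mathcomp Require Import boolp reals complex.
Set Implicit Arguments. Unset Strict Implicit. Unset Printing Implicit Defensive.
Import Order.TTheory GRing.Theory Num.Theory.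
Local Open Scope ring_scope.

(** Let [C] be the integer matrix of a self-similarity and [d = deg f].  Since
    [f(A) = 0], non-degeneracy forces [f(C) = 0]; as [f] is irreducible, the
    characteristic polynomial of [C] is [f^N], so that [s = N d] and every
    multiplicity of [A] is at most [N].  If [m = M] then [n = M d < s], hence
    [N > M].

    Conversely, let [F] be the companion matrix of [f] and let [C] act on the
    integer matrices of size [N x d], i.e. on [Z^(N d)], by right multiplication by
    [F].  When [n < N d] and all multiplicities of [A] are at most [N], there is a
    real decomposition of [C] with blocks [A] and [B].  Left multiplication by a
    real matrix [G] commutes with [C], so the decomposition may be twisted by [G].
    Evaluating on complex eigenvectors, each of the three genericity conditions
    becomes [tr (G P) <> 0] or [tr (G^-1 Q) <> 0] for countably many nonzero complex
    matrices [P] and [Q]: here density is reduced, by Kronecker's theorem, to the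
    absence of nonzero linear forms with integral values on the lattice.  Such a
    [G] exists of the form [1 + a b^T], where the entries of [a] and [b] are powers
    of a real number [t] avoiding countably many roots. *)

(** * Density of finitely generated subgroups *)

Local Notation zmx := (map_mx (fun z : int => z%:~R)).

Lemma row_free_col_mx_row (F : fieldType) q k (U : 'M[F]_(q, k)) (v : 'rV_k) :
  row_free U -> ~~ (v <= U)%MS -> row_free (col_mx U v).
Proof.
move=> fr ns; rewrite /row_free eqn_leq rank_leq_row /= -addsmxE.
have /rank_ltmx : (U < U + v)%MS.
  by rewrite ltmxE addsmxSl addsmx_sub submx_refl.
by rewrite (eqP fr) addn1.
Qed.

(** Pigeonhole: of the multiples of [u] by 0, ..., n^p, two have their fractional parts in the same
    cube of side 1/n; [D] is the difference of their multipliers. *)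
Lemma dirichlet_approx (R : realType) p (u : 'rV[R]_p) n : (0 < n)%N ->
  exists (D : nat) (z : 'rV[int]_p),
    (0 < D)%N /\ forall i, `|D%:R * u 0 i - (z 0 i)%:~R| < n%:R^-1.
Proof.
case: n => // n _.
pose fr (x : R) := x - (Num.floor x)%:~R.
have fr_ge0 x : 0 <= fr x by rewrite subr_ge0 floor_le.
have fr_lt1 x : fr x < 1 by rewrite ltrBlDl -[1]/(1%:~R) -intrD floorD1_gt.
pose box (m : 'I_(n.+1 ^ p).+1) : {ffun 'I_p -> 'I_n.+1} :=
  [ffun i => inord (Num.truncn (n.+1%:R * fr (m%:R * u 0 i)))].
have [inj|] := pselect (injective box).
  have := leq_card _ inj; rewrite card_ffun !card_ord ltnn //.
move=> /injectiveP/injectivePn/= [a [b nab eab]].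
wlog lt_ab : a b nab eab / (a < b)%N.
  move=> H; case: (ltngtP a b) => [|ba|/val_inj ab]; first exact: H.
    by apply: (H b a) => //; rewrite eq_sym.
  by rewrite ab eqxx in nab.
exists (b - a)%N, (\row_i (Num.floor (b%:R * u 0 i) - Num.floor (a%:R * u 0 i))).
split=> [|i]; first by rewrite subn_gt0.
rewrite mxE natrB ?(ltnW lt_ab) // mulrBl intrB.
have -> : b%:R * u 0 i - a%:R * u 0 i -
   ((Num.floor (b%:R * u 0 i))%:~R - (Num.floor (a%:R * u 0 i))%:~R)
   = fr (b%:R * u 0 i) - fr (a%:R * u 0 i) by rewrite /fr !opprD !opprK addrACA.
have /ffunP/(_ i) := eab; rewrite !ffunE => /(congr1 val).
set x := fr _; set y := fr _.
have bd t : 0 <= fr t -> (Num.truncn (n.+1%:R * fr t) < n.+1)%N.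
  by move=> t0; rewrite truncn_lt_nat ?mulr_ge0 // gtr_pMr.
rewrite /= !inordK ?bd // => e.
have n0 : 0 < n.+1%:R :> R by rewrite ltr0Sn.
rewrite -(ltr_pM2l n0) mulfV ?gt_eqF // -{1}(gtr0_norm n0) -normrM mulrBr.
have /andP[y1 y2] := truncn_itv (mulr_ge0 (ltW n0) (fr_ge0 (a%:R * u 0 i))).
have /andP[x1 x2] := truncn_itv (mulr_ge0 (ltW n0) (fr_ge0 (b%:R * u 0 i))).
rewrite -/x -/y e in x1 x2 y1 y2 *.
rewrite ltr_norml ltrBrDl ltrBlDl ltrBlDr.
by rewrite (lt_le_trans x2) 1?(lt_le_trans y2) // -natr1 addrC lerD2l.
Qed.

Section Kronecker.
Variables (R : realType) (s k : nat) (Y : 'M[R]_(s, k)).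

Definition small p (e : R) (u : 'M[R]_(p, k)) := forall i j, `|u i j| < e.

Definition small_indep (e : R) q :=
  exists r : 'M[int]_(q, s), row_free (zmx r *m Y) /\ small e (zmx r *m Y).

Lemma small_indep_leq e q : small_indep e q -> (q <= k)%N.
Proof. by case=> r [fr _]; rewrite -(eqP fr) rank_leq_col. Qed.

(* The resulting span V of the small elements lies in the closure of the group,
   and the group is discrete modulo V. *)
Lemma small_indep_max : exists q, (forall e, 0 < e -> small_indep e q) /\
  exists2 e, 0 < e & ~ small_indep e q.+1.
Proof.
have ex0 : exists q, `[< forall e, 0 < e -> small_indep e q >].
  exists 0%N; apply/asboolP => e e0; exists 0; split; last by move=> [].
  by rewrite /row_free; apply/eqP; apply/eqP; rewrite -leqn0 rank_leq_row.
have ub q : `[< forall e, 0 < e -> small_indep e q >] -> (q <= k)%N.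
  by move=> /asboolP /(_ 1 ltr01); apply: small_indep_leq.
case: (ex_maxnP ex0 ub) => q /asboolP Pq qmax; exists q; split=> //.
apply: contrapT => H.
suff /qmax : `[< forall e, 0 < e -> small_indep e q.+1 >] by rewrite ltnn.
by apply/asboolP => e e0; apply: contrapT => nP; apply: H; exists e.
Qed.

Lemma zmxM p q r (a : 'M[int]_(p, q)) (b : 'M[int]_(q, r)) :
  zmx (a *m b) = zmx a *m zmx b :> 'M[R]_(p, r).
Proof. by rewrite map_mxM. Qed.

(** Rounding down the coordinates of [v] leaves [q] coefficients in [0, 1), so the error is at most
    [q * e]; the factor [q.+1] keeps the bound strict even for [q = 0]. *)
Lemma span_approx q (e : R) (r : 'M[int]_(q, s)) (v : 'rV[R]_k) :
  small e (zmx r *m Y) -> 0 < e -> (v <= zmx r *m Y)%MS ->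
  exists g : 'rV[int]_s, small (q.+1%:R * e) (v - zmx g *m Y)
   /\ (zmx g *m Y <= zmx r *m Y)%MS.
Proof.
move=> sm e0 /submxP[c ->].
pose fl : 'rV[int]_q := map_mx Num.floor c.
exists (fl *m r); rewrite zmxM -!mulmxA; split; last exact: submxMl.
move=> i j; rewrite -mulmxBl mxE.
apply: le_lt_trans (ler_norm_sum _ _ _) _.
have -> : q.+1%:R * e = \sum_(l < q) e + e.
  by rewrite sumr_const card_ord -[e *+ q]mulr_natl -natr1 mulrDl mul1r.
apply: le_lt_trans (_ : _ <= \sum_(l < q) e) _; last by rewrite ltrDl.
apply: ler_sum => l _; rewrite normrM -[leRHS]mul1r.
apply: ler_pM => //; last exact/ltW.
rewrite !mxE ger0_norm; last by rewrite subr_ge0 floor_le.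
by rewrite lerBlDl ltW // -[1]/(1%:~R) -intrD floorD1_gt.
Qed.

(** Otherwise appending [g] to [r] would give [q.+1] independent elements below [e0]. *)
Lemma small_in_span q e0 e (r : 'M[int]_(q, s)) (g : 'rV[int]_s) :
  ~ small_indep e0 q.+1 -> e <= e0 -> row_free (zmx r *m Y) ->
  small e (zmx r *m Y) -> small e0 (zmx g *m Y) -> (zmx g *m Y <= zmx r *m Y)%MS.
Proof.
move=> H le fr sr sg; apply: contrapT => /negP ns; apply: H.
rewrite /small_indep -(addn1 q).
exists (col_mx r g); rewrite map_col_mx mul_col_mx; split; last first.
  move=> i j; rewrite -(splitK i); case: (split i) => i' /=.
    by rewrite col_mxEu; apply: lt_le_trans le.
  by rewrite col_mxEd.
exact: row_free_col_mx_row.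
Qed.

(** The rows of [Y] span the space, so one of them can be appended to any family that is not yet a
    basis; a family of maximal length is complete. *)
Lemma span_complete q (W : 'M[R]_(q, k)) : row_full Y -> row_free W ->
  exists p (T : 'M[int]_(p, s)),
    (q + p)%N = k /\ row_free (col_mx W (zmx T *m Y)).
Proof.
move=> fY fW.
pose P p := `[< exists T : 'M[int]_(p, s), row_free (col_mx W (zmx T *m Y)) >].
have ex0 : exists p, P p.
  exists 0%N; apply/asboolP; exists 0.
  rewrite /row_free eqn_leq rank_leq_row /= -addsmxE.
  apply: leq_trans (mxrankS (addsmxSl _ _)).
  by rewrite (eqP fW) addn0.
have ub p : P p -> (p <= k)%N.
  move=> /asboolP[T fr]; apply: leq_trans (leq_addl q p) _.
  by rewrite -(eqP fr) rank_leq_col.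
case: (ex_maxnP ex0 ub) => p /asboolP[T fr] pmax.
exists p, T; split=> //.
suff sY : (Y <= col_mx W (zmx T *m Y))%MS.
  have := mxrankS sY; rewrite (eqP fr) (eqP fY) => le1.
  have := rank_leq_col (col_mx W (zmx T *m Y)); rewrite (eqP fr) => le2.
  by apply/eqP; rewrite eqn_leq le1 le2.
apply/row_subP => j; apply: contrapT => /negP ns.
suff /pmax : P p.+1 by rewrite ltnn.
apply/asboolP; rewrite -(addn1 p).
exists (col_mx T (delta_mx 0 j)).
rewrite map_col_mx mul_col_mx col_mxA.
have -> : zmx (delta_mx 0 j : 'rV[int]_s) *m Y = row j Y.
  by rewrite rowE map_delta_mx.
by rewrite row_free_castmx; apply: row_free_col_mx_row.
Qed.

(** Subtracting a suitable group element of the span makes an element near the span small, and small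
    elements lie in the span by maximality of [q]. *)
Lemma span_discrete q e0 (r : 'M[int]_(q, s)) : 0 < e0 ->
  (forall e, 0 < e -> small_indep e q) -> ~ small_indep e0 q.+1 ->
  row_free (zmx r *m Y) -> small e0 (zmx r *m Y) ->
  exists2 e, 0 < e & forall (g : 'rV[int]_s) (v : 'rV_k),
    (v <= zmx r *m Y)%MS -> small e (zmx g *m Y - v) ->
    (zmx g *m Y <= zmx r *m Y)%MS.
Proof.
move=> e00 Hq Nq fr sr; exists (e0 / 2); first by rewrite divr_gt0.
move=> g v vW sg.
(* Half of [e0] bounds the distance to [v]; since [span_approx] loses a factor [q.+1], the other
   half bounds the approximation of [v]. *)
have e0' : 0 < e0 / 2 / q.+1%:R by rewrite !divr_gt0.
have le' : e0 / 2 / q.+1%:R <= e0.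
  rewrite -mulrA ler_piMr ?(ltW e00) // -invfM invf_le1 ?mulr_gt0 //.
  by rewrite -natrM ler1n.
have [r' [fr' sr']] := Hq _ e0'.
have r'W : (zmx r' *m Y <= zmx r *m Y)%MS.
  apply/row_subP => i; rewrite row_mul -map_row.
  apply: (small_in_span Nq (lexx _) fr sr) => a b.
  rewrite map_row -row_mul mxE; exact: lt_le_trans (sr' _ _) le'.
have Wr' : (zmx r *m Y <= zmx r' *m Y)%MS.
  by rewrite -(geq_leqif (mxrank_leqif_sup r'W)) (eqP fr) (eqP fr').
have [h [sh hr']] := span_approx sr' e0' (submx_trans vW Wr').
have -> : zmx g *m Y = zmx (g - h) *m Y + zmx h *m Y.
  by rewrite -mulmxDl -map_mxD subrK.
apply: addmx_sub; last exact: submx_trans hr' r'W.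
apply: (small_in_span Nq (lexx _) fr sr) => i j.
rewrite map_mxB mulmxBl -(subrK v (zmx g *m Y)) -addrA mxE.
apply: le_lt_trans (ler_normD _ _) _; rewrite [e0]splitr.
apply: ltrD; first exact: sg.
have := sh i j; rewrite mulrCA mulfV ?mulr1 //.
by rewrite pnatr_eq0.
Qed.

(** If the small elements span everything, rounding gives density. Otherwise the group is discrete
    modulo their span, so its coordinates in complementary directions are rational; clearing
    denominators in one direction gives a nonzero form integral on the group. *)
Theorem kronecker : row_full Y ->
  (forall phi : 'cV[R]_k, (exists z : 'cV[int]_s, Y *m phi = zmx z) -> phi = 0) ->
  forall (y : 'rV[R]_k) e, 0 < e ->
  exists g : 'rV[int]_s, small e (y - zmx g *m Y).
Proof.
move=> fY H y e e0; have [q [Hq [e1 e10 Nq]]] := small_indep_max.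
have [kq|qk] := leqP k q.
  have e0' : 0 < e / q.+1%:R by rewrite divr_gt0.
  have [r [fr sr]] := Hq _ e0'.
  have yW : (y <= zmx r *m Y)%MS.
    apply: submx_full; rewrite /row_full eqn_leq rank_leq_col.
    by rewrite (eqP fr).
  have [g [sg _]] := span_approx sr e0' yW; exists g => i j.
  have := sg i j; rewrite mulrCA mulfV ?mulr1 //.
  by rewrite pnatr_eq0.
have [r [fr sr]] := Hq _ e10.
have [d d0 disc] := span_discrete e10 Hq Nq fr sr.
have [p [T [qpk fE]]] := span_complete fY fr.
set W := zmx r *m Y in fE disc; set E := col_mx _ _ in fE.
have fullE : row_full E by rewrite /row_full (eqP fE) qpk.
have YE : Y *m pinvmx E *m E = Y by rewrite mulmxKpV ?submx_full.
have p0 : (0 < p)%N by rewrite -(ltn_add2l q) addn0 qpk.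
set c := Y *m pinvmx E in YE; pose U := rsubmx c.
have YU j : row j Y = row j (lsubmx c) *m W + row j U *m (zmx T *m Y).
  by rewrite -!row_mul -linearD /= -mul_row_col hsubmxK YE.
(* Dirichlet brings [D] times the coordinates so close to an integer vector [z] that [D] times row
   [j] minus [z *m T *m Y] is within [d] of [W]. It then lies in [W], and independence of [E] makes
   the approximation exact. *)
have rat j : exists D, (0 < D)%N /\ exists z : 'rV[int]_p, D%:R *: row j U = zmx z.
  pose S : R := \sum_l \sum_i `|(zmx T *m Y) l i|.
  have S0 : 0 <= S by apply: sumr_ge0 => *; apply: sumr_ge0.
  have [D [z [D0 Dz]]] := dirichlet_approx (row j U) (ltn0Sn (Num.truncn (S / d))).
  exists D; split=> //; exists z; apply/eqP; rewrite -subr_eq0; apply/eqP.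
  pose g : 'rV[int]_s := D%:R *: delta_mx 0 j - z *m T.
  have gY : zmx g *m Y = D%:R *: row j (lsubmx c) *m W
                + (D%:R *: row j U - zmx z) *m (zmx T *m Y).
    rewrite map_mxB mulmxBl map_mxM mulmxBl addrA -!scalemxAl -scalerDr -YU mulmxA.
    by rewrite map_mxZ map_delta_mx rmorph_nat -scalemxAl -rowE.
  have : (zmx g *m Y <= W)%MS.
    apply: (disc _ (D%:R *: row j (lsubmx c) *m W)); first exact: submxMl.
    move=> a b; rewrite gY [X in X - _]addrC addrK mxE.
    apply: le_lt_trans (ler_norm_sum _ _ _) _.
    apply: (@le_lt_trans _ _ ((Num.truncn (S / d)).+1%:R^-1 * S)); last first.
      by rewrite mulrC ltr_pdivrMr // mulrC -ltr_pdivrMr // truncnS_gt.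
    rewrite mulr_sumr; apply: ler_sum => l _; rewrite normrM.
    apply: ler_pM => //; last by rewrite (bigD1 b) //= lerDl sumr_ge0.
    by move: (Dz l); rewrite !mxE ord1 => /ltW.
  rewrite gY => /submxP[x /eqP]; rewrite -subr_eq0 addrAC -mulmxBl -mul_row_col.
  move=> /eqP /(congr1 (mulmx^~ (pinvmx E))); rewrite mul0mx -mulmxA mulmxVp // mulmx1.
  by move/(congr1 rsubmx); rewrite row_mxKr linear0.
have [D DP] := fin_all_exists rat.
pose P := (\prod_j D j)%N.
have P0 : P%:R != 0 :> R.
  by rewrite pnatr_eq0 -lt0n prodn_gt0 // => j; case: (DP j).
pose i0 : 'I_p := Ordinal p0.
(* The first coordinate along [T], scaled by the common denominator [P]. *)
pose phi : 'cV[R]_k := P%:R *: (pinvmx E *m delta_mx (rshift q i0) 0).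
have phi0 : phi = 0.
  apply: H.
  have zP j : exists z : int, P%:R * U j i0 = z%:~R.
    have [_ [z /rowP/(_ i0)]] := DP j; rewrite !mxE => e2.
    exists ((\prod_(l | l != j) D l)%:R * z 0 i0).
    rewrite /P (bigD1 j) //= natrM intrM -e2 rmorph_nat.
    by rewrite mulrA [X in X * _]mulrC.
  have [z zE] := fin_all_exists zP.
  exists (\col_j z j); apply/colP => j.
  rewrite /phi -scalemxAr mulmxA -/c -colE !mxE -zE !mxE //.
have : E *m phi = 0 by rewrite phi0 mulmx0.
rewrite /phi -scalemxAr mulmxA mulmxVp // mul1mx => /colP/(_ (rshift q i0)).
by rewrite !mxE !eqxx mulr1 => /eqP; rewrite (negPf P0).
Qed.

End Kronecker.

(** * Generic rank-one perturbations of the identity *)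

(** Nested intervals: step [n] passes to a subinterval whose closure misses [x n], and the supremum
    of the left ends lies in every closure. *)
Lemma cantor_seq (R : realType) (x : nat -> R) : exists t, forall i, x i != t.
Proof.
pose mid (ab : R * R) := (ab.1 + ab.2) / 2.
(* The left half is halved again, so that [y] is excluded even if it is the midpoint. *)
pose next (y : R) ab := if y < mid ab then (mid ab, ab.2)
                        else (ab.1, mid (ab.1, mid ab)).
pose I := fix I n := if n is n'.+1 then next (x n') (I n') else (0, 1).
have midP a b : a < b -> a < mid (a, b) /\ mid (a, b) < b.
  by move=> ab; rewrite /mid /= !(midf_lt ab).
have next_lt y ab : ab.1 < ab.2 -> (next y ab).1 < (next y ab).2.
  case: ab => a b /= ab; have [h1 h2] := midP _ _ ab.
  by rewrite /next; case: ifP => _ //=; apply: (midP _ _ h1).1.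
have I_lt n : (I n).1 < (I n).2 by elim: n => [|n IH]; [exact: ltr01|exact: next_lt].
have step n : (I n).1 <= (I n.+1).1 /\ (I n.+1).2 <= (I n).2.
  rewrite /=; case: (I n) (I_lt n) => a b /= ab; have [h1 h2] := midP _ _ ab.
  rewrite /next; case: ifP => _ /=; split=> //; first exact: ltW.
  by apply: ltW (lt_trans (midP _ _ h1).2 h2).
have mono1 m n : (m <= n)%N -> (I m).1 <= (I n).1.
  move=> /subnKC <-; elim: (n - m)%N => [|l IH]; first by rewrite addn0.
  by rewrite addnS (le_trans IH) ?(step _).1.
have mono2 m n : (m <= n)%N -> (I n).2 <= (I m).2.
  move=> /subnKC <-; elim: (n - m)%N => [|l IH]; first by rewrite addn0.
  by rewrite addnS (le_trans _ IH) ?(step _).2.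
have cross m n : (I m).1 <= (I n).2.
  apply: le_trans (mono1 _ _ (leq_maxl m n)) _.
  by apply: le_trans (ltW (I_lt _)) (mono2 _ _ (leq_maxr m n)).
pose A : classical_sets.set R := fun y => exists n, y = (I n).1.
have hA : classical_sets.has_sup A.
  split; first by exists (I 0%N).1, 0%N.
  by exists (I 0%N).2 => _ [n ->].
have ge n : (I n).1 <= sup A by apply: sup_upper_bound => //; exists n.
have le n : sup A <= (I n).2 by apply: ge_sup; [exact: hA.1 | move=> _ [m ->]].
exists (sup A) => n; have := ge n.+1; have := le n.+1; have := I_lt n.
rewrite /=; case: (I n) => a b /= ab; have [m1 m2] := midP _ _ ab.
rewrite /next; case: ltP => h /= h1 h2; first by rewrite lt_eqF ?(lt_le_trans h).
by rewrite gt_eqF //; apply: le_lt_trans h1 (lt_le_trans (midP _ _ m1).2 h).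
Qed.

Section Generic.
Variable R : realType.
Local Notation C := (complex R).

(** A real root is its own real part, so it suffices to avoid the countably many real parts of all
    roots. *)
Lemma avoid_roots (I : countType) (p : I -> {poly C}) :
  (forall i, p i != 0) -> exists t : R, forall i, ~~ root (p i) (t%:C)%C.
Proof.
move=> p0; pose r i := sval (closed_field_poly_normal (p i)).
pose x n := if unpickle n is Some (i, l) then complex.Re (nth 0 (r i) l) else 0 : R.
have [t xt] := cantor_seq x; exists t => i.
rewrite (svalP (closed_field_poly_normal (p i))) -/(r i).
rewrite rootZ ?lead_coef_eq0 // root_prod_XsubC; apply/negP => ti.
have := xt (pickle (i, index (t%:C)%C (r i))).
by rewrite /x pickleK nth_index ?eqxx.
Qed.

Section RankOne.
Variable N : nat.
Implicit Types (M : 'M[C]_N) (c : C).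

(** The exponents are positive and, by division by [N], pairwise distinct, so nothing cancels. The
    value at [t] is [c + b M a], with [b] the row of the [t ^ (i.+1 * N)] and [a] the column of the
    [t ^ j]. *)
Definition bform_poly c M : {poly C} :=
  c%:P + \sum_i \sum_j M i j *: 'X^(i.+1 * N + j).

Lemma bform_poly_neq0 c M : c != 0 \/ M != 0 -> bform_poly c M != 0.
Proof.
have gt0 (i j : 'I_N) : (0 < i.+1 * N + j)%N.
  by rewrite mulSn -!addnA ltn_addr // (leq_trans _ (ltn_ord i)).
move=> H; apply/eqP => p0.
have c0 : c = 0.
  have /(congr1 (coefp 0)) := p0; rewrite /bform_poly /= coefD coefC coef_sum coef0.
  rewrite big1 ?addr0 // => i _; rewrite coef_sum big1 // => j _.
  by rewrite coefZ coefXn eq_sym gtn_eqF ?gt0 ?mulr0.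
have coefM i j : M i j = 0.
  have /(congr1 (coefp (i.+1 * N + j)%N)) := p0; rewrite /bform_poly /= coefD coefC.
  rewrite gtn_eqF ?gt0 // add0r coef0 coef_sum (bigD1 i) //= coef_sum (bigD1 j) //=.
  have inj (i' j' : 'I_N) : (i.+1 * N + j == i'.+1 * N + j')%N = (i == i') && (j == j').
    apply/eqP/andP => [e|[/eqP-> /eqP->] //].
    have N0 : (0 < N)%N by rewrite (leq_trans _ (ltn_ord i)).
    have := congr1 (divn^~ N) e; have := congr1 (modn^~ N) e.
    rewrite !modnMDl !modn_small ?divnMDl ?divn_small ?addn0 ?ltn_ord //.
    by move=> ej [ei]; split; apply/eqP/val_inj.
  rewrite coefZ coefXn eqxx mulr1 big1 => [|j' nj]; last first.
    by rewrite coefZ coefXn inj eqxx eq_sym (negPf nj) mulr0.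
  rewrite addr0 big1 ?addr0 // => i' ni; rewrite coef_sum big1 // => j' _.
  by rewrite coefZ coefXn inj eq_sym (negPf ni) mulr0.
by case: H => [/eqP|/eqP] //; apply; apply/matrixP => i j; rewrite coefM mxE.
Qed.

(** Take [G = 1 + a b], with inverse [H = 1 - w^-1 a b] for [w = 1 + b a]. Then
    [tr (G P) = tr P + b P a] and [w tr (H Q) = tr Q + b (tr Q - Q) a], so each condition, [w != 0]
    included, says that [t] is not a root of some [bform_poly]. *)
Lemma generic_mx (I J : countType) (P : I -> 'M[C]_N) (Q : J -> 'M[C]_N) :
  (forall i, P i != 0) -> (forall j, Q j != 0) ->
  exists G H : 'M[R]_N, [/\ G *m H = 1%:M,
     forall i, \tr (cmx G *m P i) != 0 & forall j, \tr (cmx H *m Q j) != 0].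
Proof.
move=> P0 Q0.
pose p (x : option (I + J)) := match x with
  | None => bform_poly 1 1%:M
  | Some (inl i) => bform_poly (\tr (P i)) (P i)
  | Some (inr j) => bform_poly (\tr (Q j)) ((\tr (Q j))%:M - Q j) end.
have [|t tP] := @avoid_roots (option (I + J)) p.
  case=> [[i|j]|] /=; apply: bform_poly_neq0; [by right| |by left; exact: oner_neq0].
  (* If [tr Q = 0], the matrix is [- Q], which is nonzero; otherwise the constant term is
     nonzero. *)
  have [->|] := eqVneq (\tr (Q j)) 0; last by left.
  by right; rewrite raddf0 sub0r oppr_eq0.
pose a : 'cV[R]_N := \col_i t ^+ i; pose b : 'rV[R]_N := \row_i t ^+ (i.+1 * N).
pose ca : 'cV[C]_N := map_mx (fun x : R => (x%:C)%C) a.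
pose cb : 'rV[C]_N := map_mx (fun x : R => (x%:C)%C) b.
have pE c M : (bform_poly c M).[(t%:C)%C] = c + (cb *m M *m ca) 0 0.
  rewrite /bform_poly hornerD hornerC horner_sum; congr (_ + _).
  under eq_bigr do rewrite horner_sum.
  rewrite exchange_big mxE; apply: eq_bigr => j _.
  rewrite !mxE mulr_suml; apply: eq_bigr => i _.
  by rewrite !mxE hornerZ hornerXn exprD !rmorphXn mulrCA mulrA.
pose w := 1 + (b *m a) 0 0.
have wC : (w%:C)%C = (bform_poly 1 1%:M).[(t%:C)%C].
  by rewrite pE mulmx1 -map_mxM mxE rmorphD rmorph1.
have w0 : w != 0.
  have := tP None; rewrite /root /= -wC; apply: contra => /eqP ->; by [].
exists (1%:M + a *m b), (1%:M - w^-1 *: (a *m b)); split.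
- have SS : a *m b *m (a *m b) = (w - 1) *: (a *m b).
    rewrite mulmxA -(mulmxA a b a) [b *m a]mx11_scalar mul_mx_scalar -scalemxAl.
    by rewrite /w addrC addrA addNr add0r.
  rewrite mulmxDl mul1mx mulmxBr mulmx1 -scalemxAr SS scalerA mulrBr mulr1 mulVf //.
  by rewrite scalerBl scale1r opprB [a *m b + _]addrC !subrK.
- move=> i; have := tP (Some (inl i)); rewrite /root pE.
  rewrite /cmx map_mxD map_mx1 mulmxDl mul1mx raddfD /= map_mxM.
  rewrite mxtrace_mulC mulmxA mxtrace_mulC mulmxA.
  by rewrite trace_mx11.
- move=> j; have := tP (Some (inr j)); rewrite /root pE.
  apply: contra => /eqP e.
  have : (w%:C)%C * \tr (cmx (1%:M - w^-1 *: (a *m b)) *m Q j) = 0 by rewrite e mulr0.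
  rewrite /cmx map_mxB map_mx1 map_mxZ mulmxBl mul1mx raddfB /= map_mxM.
  rewrite -scalemxAl mxtraceZ mxtrace_mulC mulmxA mxtrace_mulC mulmxA trace_mx11.
  rewrite mulrBr mulrA -rmorphM mulfV // rmorph1 mul1r wC pE mulmx1.
  rewrite mulmxBr mulmxBl mul_mx_scalar -scalemxAl mulrDl mul1r -addrA.
  rewrite [X in _ + (X - _)]mulrC => h; apply/eqP.
  by rewrite -[RHS]h !mxE.
Qed.

End RankOne.
End Generic.

(** * Irreducible rational polynomials *)

Local Notation ratr_poly := (map_poly ratr).

Lemma irredp_coprimep (F : fieldType) (f g : {poly F}) :
  irreducible_poly f -> ~~ (f %| g) -> coprimep f g.
Proof.
move=> firr ndvd; rewrite -gcdp_eqp1; have dl := dvdp_gcdl f g.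
have [//|e] := irredp_XsubCP firr dl.
by move: ndvd; rewrite -(eqp_dvdl _ e) dvdp_gcdr.
Qed.

Lemma irredp_separable (F : fieldType) (f : {poly F}) :
  [pchar F] =i pred0 -> irreducible_poly f -> separable_poly f.
Proof.
move=> /pcharf0P ch firr; rewrite unlock; apply: (irredp_coprimep firr).
have s1 : (1 < size f)%N := firr.1.
have f'0 : f^`() != 0.
  apply/eqP => /(congr1 (coefp (size f).-2)) /=.
  rewrite coef_deriv coef0 -mulr_natr.
  have -> : (size f).-2.+1 = (size f).-1 by case: (size f) s1 => [|[]].
  rewrite -lead_coefE => /eqP; rewrite mulf_eq0 lead_coef_eq0 ch.
  by rewrite (negPf (irredp_neq0 firr)) /=; case: (size f) s1 => [|[]].
by apply/negP => /(dvdp_leq f'0); rewrite leqNgt lt_size_deriv ?irredp_neq0.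
Qed.

Section MinPoly.
Variable C : numClosedFieldType.
Variable f : {poly rat}.

Lemma min_size_root_irreducible (z : C) :
  f \is monic -> root (ratr_poly f) z ->
  (forall g : {poly rat}, g != 0 -> root (ratr_poly g) z -> (size f <= size g)%N) ->
  irreducible_poly f.
Proof.
move=> fm fz fmin; have f0 := monic_neq0 fm.
have f0' : map_poly (@ratr C) f != 0 by rewrite map_poly_eq0.
split; first by rewrite -(size_map_poly (@ratr C)) (root_size_gt1 f0' fz).
move=> g g1 gf; have /dvdpP[h fE] := gf.
have : h * g != 0 by rewrite -fE.
rewrite mulf_eq0 negb_or => /andP[h0 g0].
have : root (map_poly (@ratr C) (h * g)) z by rewrite -fE.
rewrite rmorphM rootM => /orP[/(fmin _ h0) s1|/(fmin _ g0) s1]; last first.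
  by rewrite -dvdp_size_eqp // eqn_leq s1 dvdp_leq.
move: s1 g1; rewrite fE size_mul //; have := g0; rewrite -size_poly_gt0.
case: (size g) => // m _; rewrite addnS /= -[X in (_ <= X)%N]addn0 leq_add2l leqn0.
by move/eqP->.
Qed.

Hypothesis firr : irreducible_poly f.

Lemma irredp_dvdp_root (g : {poly rat}) (z : C) :
  root (ratr_poly f) z -> root (ratr_poly g) z -> f %| g.
Proof.
move=> fz gz; apply: contraT => /(irredp_coprimep firr).
rewrite -(coprimep_map (@ratr C)) => /coprimep_root/(_ fz).
by rewrite (eqP gz) eqxx.
Qed.

Hypothesis fm : f \is monic.

Lemma irredp_split :
  exists rs : seq C, [/\ uniq rs, ratr_poly f = \prod_(z <- rs) ('X - z%:P)
                     & size rs = (size f).-1].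
Proof.
have [rs] := closed_field_poly_normal (map_poly (@ratr C) f).
have -> : lead_coef (map_poly (@ratr C) f) = 1 by rewrite lead_coef_map (eqP fm) rmorph1.
rewrite scale1r => fE; exists rs; split=> //.
  rewrite -separable_prod_XsubC -fE separable_map.
  by apply: irredp_separable firr; apply: pchar_num.
by rewrite -(size_map_poly (@ratr C)) fE size_prod_XsubC.
Qed.

(** A nonconstant [g] shares a root with [f], hence is divisible by [f], and the monic quotient
    again has only roots of [f]. *)
Lemma monic_expr_of_roots (g : {poly rat}) :
  g \is monic -> (forall z : C, root (ratr_poly g) z -> root (ratr_poly f) z) ->
  exists N, g = f ^+ N.
Proof.
have [n] := ubnP (size g); elim: n g => // n IH g; rewrite ltnS => sg gm H.
have [s1|s1] := eqVneq (size g) 1%N.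
  exists 0%N; rewrite expr0; have /size_poly1P[c c0 gE] : size g == 1%N by rewrite s1.
  by move: gm; rewrite gE monicE lead_coefC => /eqP ->.
have [z gz] : exists z : C, root (ratr_poly g) z by apply/closed_rootP; rewrite size_map_poly.
have /dvdpP[h gE] := irredp_dvdp_root (H z gz) gz.
have hm : h \is monic by rewrite gE monicMr in gm.
have hs : (size h < n)%N.
  apply: leq_trans sg; rewrite gE size_mul ?monic_neq0 //.
  by case: (size f) firr.1 => [|[|m]] // _; rewrite !addnS /= ltnS leq_addr.
have [y hy|N hE] := IH h hs hm; first by apply: H; rewrite gE rmorphM rootM hy.
by exists N.+1; rewrite gE hE exprSr.
Qed.

(** By Gauss's lemma [f] is [a] times an integral factor [q] of [p]. As [p] is monic, [lead_coef q]
    is a sign, and [a] is the same sign. *)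
Lemma monic_int_of_algebraic_integer (z : C) (p : {poly int}) :
  root (ratr_poly f) z -> p \is monic -> root (map_poly intr p) z ->
  exists2 g : {poly int}, g \is monic & f = map_poly intr g.
Proof.
move=> fz pm pz.
have /dvdpP_rat_int[q [a a0 fE] [r pE]] : f %| map_poly intr p.
  apply: (irredp_dvdp_root fz); rewrite -map_poly_comp /=.
  by rewrite (eq_map_poly (fun x => ratr_int _ x)).
have : lead_coef q * lead_coef r = 1 by rewrite -lead_coefM -pE (eqP pm).
move=> lr; have lu : lead_coef q \is a GRing.unit by apply/unitrPr; exists (lead_coef r).
have fl : a * (lead_coef q)%:~R = 1.
  rewrite -[RHS](eqP fm) fE lead_coefZ; congr (_ * _).
  by rewrite /lead_coef size_rat_int_poly coef_map.
have a1 : a = (lead_coef q)%:~R.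
  have q2 : lead_coef q * lead_coef q = 1.
    by move: lu; rewrite qualifE /= => /orP[] /eqP ->.
  transitivity (a * (lead_coef q)%:~R * (lead_coef q)%:~R); last by rewrite fl mul1r.
  by rewrite -mulrA -intrM q2 mulr1.
exists (lead_coef q *: q); last by rewrite fE a1 map_polyZ.
rewrite monicE lead_coefZ.
by move: lu; rewrite qualifE /= => /orP[] /eqP ->.
Qed.

End MinPoly.

(** * Matrices over an irreducible polynomial *)

Lemma horner_mx_intertwine (F : comNzRingType) m n (X : 'M[F]_(m.+1, n.+1)) A C p :
  X *m C = A *m X -> X *m horner_mx C p = horner_mx A p *m X.
Proof.
move=> e; elim/poly_ind: p => [|p c IH]; first by rewrite !rmorph0 mulmx0 mul0mx.
rewrite !rmorphD !rmorphM /= !horner_mx_X !horner_mx_C mulmxDr mulmxDl -scalar_mxC.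
by rewrite [_ * C]/(_ *m C) [_ * A]/(_ *m A) mulmxA IH -!mulmxA e.
Qed.

Lemma horner_mx_eigenvector (F : comNzRingType) n (A : 'M[F]_n.+1) (l : 'rV_n.+1) b p :
  l *m A = b *: l -> l *m horner_mx A p = p.[b] *: l.
Proof.
move=> e; elim/poly_ind: p => [|p c IH]; first by rewrite !rmorph0 mulmx0 horner0 scale0r.
rewrite !rmorphD !rmorphM /= !horner_mx_X !horner_mx_C !hornerE mulmxDr scalerDl.
rewrite mul_mx_scalar; congr (_ + _).
by rewrite [_ * A]/(_ *m A) mulmxA IH -scalemxAl e scalerA.
Qed.

Lemma char_poly_similar (F : fieldType) n (P A B : 'M[F]_n) :
  P \in unitmx -> P *m A = B *m P -> char_poly A = char_poly B.
Proof.
move=> Pu e; have dP : \det (map_mx (@polyC F) P) != 0.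
  by rewrite det_map_mx polyC_eq0 -unitfE -unitmxE.
apply: (mulfI dP); rewrite [RHS]mulrC /char_poly -!det_mulmx.
congr (\det _); rewrite /char_poly_mx mulmxBr mulmxBl -!map_mxM e.
by rewrite scalar_mxC.
Qed.

Lemma char_poly_block_diag (F : comNzRingType) m n (A : 'M[F]_m) (B : 'M_n) :
  char_poly (block_mx A 0 0 B) = char_poly A * char_poly B.
Proof. by rewrite /char_poly char_block_diag_mx det_ublock. Qed.

Lemma mupX (F : fieldType) (x : F) p n : p != 0 -> mup x (p ^+ n) = (n * mup x p)%N.
Proof.
move=> p0; elim: n => [|n IH]; first by rewrite mupNroot // root1.
by rewrite exprS mupM ?expf_neq0 // IH mulSn.
Qed.

Lemma size_sum_count (T : eqType) (rs es : seq T) : uniq rs -> {subset es <= rs} ->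
  size es = (\sum_(z <- rs) count_mem z es)%N.
Proof.
move=> urs; elim: es => [|x es IH] sub; first by rewrite big1.
rewrite big_split /= -IH; last by move=> y ye; rewrite sub // inE ye orbT.
rewrite -add1n; congr (_ + _)%N.
have -> : (\sum_(z <- rs) (x == z) = count_mem x rs)%N.
  by rewrite -sum1_count [RHS]big_mkcond /=; apply: eq_bigr => z _; rewrite eq_sym; case: eqP.
by rewrite count_uniq_mem // sub ?mem_head.
Qed.

Lemma diagonalizableE (F : fieldType) n (A : 'M[F]_n) : diagonalizable A ->
  exists (Q : 'M_n) d, Q \in unitmx /\ Q *m A = diag_mx d *m Q.
Proof.
by case=> Q Qu /diagonalizable_forPex[d /(simmxP Qu) e]; exists Q, d.
Qed.

(* By irreducibility q is a cyclic vector of F, and l (F^i q) = b^i (l q). *)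
Lemma irredp_eigenvector_neq0 (K : fieldType) (C : fieldType) (iota : {rmorphism K -> C})
    d (F : 'M[K]_d) (l : 'rV[C]_d) b (q : 'cV[K]_d) :
  irreducible_poly (char_poly F) -> l *m map_mx iota F = b *: l -> l != 0 ->
  q != 0 -> l *m map_mx iota q != 0.
Proof.
case: d F l q => [|d] F l q.
  by rewrite [l]thinmx0 => _ _; rewrite eqxx.
move=> firr lF l0 q0; apply: contra_neq l0 => lq.
(* The rows are the iterates of [q]. A nontrivial relation is a polynomial of degree below [d]
   killing [q] at [F]; it is coprime to the characteristic polynomial, so Bezout and Cayley-Hamilton
   force [q = 0]. *)
pose K_ : 'M[K]_d.+1 := \matrix_(i < d.+1) (F ^+ i *m q)^T.
have Ku : K_ \in unitmx.
  rewrite -row_free_unit; apply: inj_row_free => v vK.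
  have pq : horner_mx F (rVpoly v) *m q = 0.
    apply: trmx_inj; rewrite trmx0 -vK mulmx_sum_row [rVpoly v]poly_def.
    rewrite raddf_sum mulmx_suml raddf_sum; apply: eq_bigr => i _.
    by rewrite valK /= linearZ rmorphXn /= horner_mx_X -scalemxAl linearZ rowK.
  have [e|p0] := eqVneq (rVpoly v) 0.
    by rewrite -[v]rVpolyK e linear0.
  have /(irredp_coprimep firr)/Bezout_eq1_coprimepP[[u w] /= e] :
      ~~ (char_poly F %| rVpoly v).
    apply/negP => /(dvdp_leq p0); rewrite size_char_poly leqNgt ltnS.
    by rewrite (leq_trans (size_poly _ _)).
  case/eqP: q0; have := congr1 (fun p => horner_mx F p *m q) e.
  rewrite /= rmorphD !rmorphM /= (Cayley_Hamilton F) mulr0 add0r rmorph1 mul1mx => <-.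
  by rewrite [_ * _]/(_ *m _) -mulmxA pq mulmx0.
have lK : map_mx iota K_ *m l^T = 0.
  apply/row_matrixP => i; rewrite row_mul row0 -map_row rowK -map_trmx -trmx_mul.
  rewrite map_mxM rmorphXn /= mulmxA -(horner_mx_X (map_mx iota F)) -rmorphXn.
  by rewrite (horner_mx_eigenvector _ lF) -scalemxAl lq scaler0 trmx0.
apply: trmx_inj; rewrite trmx0 -[LHS](mulKmx (_ : map_mx iota K_ \in unitmx)) ?map_unitmx //.
by rewrite lK mulmx0.
Qed.

(** * Lower bound on the dimension *)

Local Notation zpoly := (map_poly (fun z : int => z%:~R)).

Lemma char_poly_diagonalizable (F : fieldType) n (A Q : 'M[F]_n) d :
  Q \in unitmx -> Q *m A = diag_mx d *m Q ->
  char_poly A = \prod_(z <- [seq d 0 i | i <- enum 'I_n]) ('X - z%:P).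
Proof.
move=> Qu e; rewrite (char_poly_similar Qu e) char_poly_trig; last exact/diag_mx_is_trig.
by rewrite big_image /=; apply: eq_bigr => i _; rewrite mxE eqxx.
Qed.

Lemma horner_mx_diagonalizable_eq0 (F : fieldType) n (A Q : 'M[F]_n.+1) d p :
  Q \in unitmx -> Q *m A = diag_mx d *m Q -> (forall i, root p (d 0 i)) ->
  horner_mx A p = 0.
Proof.
move=> Qu e H; rewrite -[LHS](mulKmx Qu) (horner_mx_intertwine _ e) horner_mx_diag.
have -> : map_mx (horner p) d = 0.
  by apply/rowP => i; rewrite !mxE; apply/eqP/H.
by rewrite linear0 mul0mx mulmx0.
Qed.

Section LowerBound.
Variable R : realType.
Local Notation C := (complex R).

Lemma self_similarity_lattice_action n k (A : 'M[R]_n) (L : 'M[R]_(n + k)) :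
  self_similarity L A -> exists (Cm : 'M[int]_(n + k)) (B : 'M[R]_k),
  block_mx A 0 0 B *m L = L *m zmx Cm /\ usubmx L *m zmx Cm = A *m usubmx L.
Proof.
case=> _ [Cm [B e]]; exists Cm, B; have := e.
rewrite -{1 2}(vsubmxK L) mul_block_col mul_col_mx !mul0mx addr0 add0r.
by move=> /eq_col_mx[-> _].
Qed.

(** [p] evaluated at [Cm] sends each basis vector of the lattice to a lattice point whose parallel
    projection factors through [p(A) = 0]; non-degeneracy makes this point zero. *)
Lemma lattice_annihilator n k (A : 'M[R]_n.+1) (L : 'M[R]_(n.+1 + k))
    (Cm : 'M[int]_(n.+1 + k)) p :
  L \in unitmx -> Defs.nondegenerate L -> usubmx L *m zmx Cm = A *m usubmx L ->
  horner_mx A (zpoly p) = 0 -> horner_mx (Cm : 'M_((n + k).+1)) p = 0.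
Proof.
move=> Lu nd e Ap; set H := horner_mx _ _.
have XH : usubmx L *m zmx H = 0.
  rewrite /H (map_horner_mx (intr : int -> R)).
  by rewrite (@horner_mx_intertwine _ n (n + k) _ A _ _ e) Ap mul0mx.
have col0 j : L *m zmx (col j H) = 0.
  apply: nd; [by exists (col j H)| exists 0; by rewrite map_mx0 mulmx0|].
  rewrite /pi_par -mul_usub_mx map_col colE mulmxA XH mul0mx linear0 //.
apply/matrixP => i j; have := congr1 (mulmx (invmx L)) (col0 j).
rewrite mulKmx // mulmx0 => /colP/(_ i); rewrite !mxE => /eqP.
by rewrite intr_eq0 => /eqP.
Qed.

(** The block form gives [char_poly A * char_poly B = f ^ N]. Degrees give the dimension; the roots
    of [f] are simple, so each has multiplicity [N] on the right, which bounds its multiplicity in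
    [A]. *)
Lemma generic_cps_dim n k (A : 'M[R]_n) (L : 'M[R]_(n + k))
    (f : {poly rat}) (g : {poly int}) :
  (0 < n)%N -> f \is monic -> irreducible_poly f -> f = map_poly intr g ->
  diagonalizable (cmx A) ->
  (forall z, eigenvalue (cmx A) z -> root (ratr_poly f) z) ->
  L \in unitmx -> Defs.nondegenerate L -> self_similarity L A ->
  exists N, (n + k = N * (size f).-1)%N /\
    forall z, root (ratr_poly f) z -> (alg_mult A z <= N)%N.
Proof.
case: n A L => // n A L _ fm firr fg /diagonalizableE[Q [d [Qu QA]]] ev Lu nd.
move=> /self_similarity_lattice_action[Cm [B [LC XC]]].
have fgC : ratr_poly f = map_poly intr g :> {poly C}.
  by rewrite fg -map_poly_comp /=; apply: eq_map_poly => x; rewrite /= ratr_int.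
have dR i : root (ratr_poly f) (d 0 i).
  apply: ev; apply/eigenvalueP; exists (row i Q).
    by rewrite -row_mul QA row_mul row_diag_mx -scalemxAl -rowE.
  apply/eqP => r0; have := congr1 (mulmx^~ (invmx Q)) r0.
  by rewrite -row_mul mulmxV // mul0mx => /rowP/(_ i)/eqP; rewrite !mxE eqxx oner_eq0.
have Ap : horner_mx A (zpoly g) = 0.
  have := horner_mx_diagonalizable_eq0 Qu QA dR.
  rewrite fgC => h; apply: (map_mx_inj (f := real_complex R)) => //.
  rewrite map_mx0 -h map_horner_mx -map_poly_comp; congr (horner_mx _ _).
  by apply: eq_map_poly => x; rewrite /= rmorph_int.
have Cp := lattice_annihilator Lu nd XC Ap.
pose CC : 'M[C]_((n + k).+1) := map_mx intr Cm.
have chi : char_poly CC = char_poly (cmx A) * char_poly (cmx B).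
  rewrite -char_poly_block_diag -(map_mx0 (real_complex R)) -(map_mx0 (real_complex R)).
  rewrite -map_block_mx; apply: (@char_poly_similar _ _ (cmx L)); first by rewrite map_unitmx.
  rewrite -map_mxM; have := congr1 (map_mx (real_complex R)) LC; rewrite !map_mxM => ->.
  by congr (_ *m _); apply/matrixP => i j; rewrite !mxE rmorph_int.
have rat_int m (M : 'M[int]_m) :
    map_mx ratr (map_mx intr M : 'M[rat]_m) = map_mx intr M :> 'M[C]_m.
  by apply/matrixP => i j; rewrite !mxE ratr_int.
have [N charE] : exists N, char_poly (map_mx intr Cm : 'M[rat]_((n + k).+1)) = f ^+ N.
  apply: (@monic_expr_of_roots C _ firr fm) => [|z].
    exact: (char_poly_monic (map_mx intr Cm : 'M[rat]_((n + k).+1))).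
  rewrite map_char_poly rat_int -root_mxminpoly.
  have : mxminpoly CC %| ratr_poly f.
    by apply: mxminpoly_min; rewrite fgC -map_horner_mx Cp map_mx0.
  by move=> /dvdpP[h ->]; rewrite rootM orbC => ->.
exists N; split.
  have := size_char_poly (map_mx intr Cm : 'M[rat]_((n + k).+1)).
  by rewrite charE => e; have := size_exp f N; rewrite e mulnC.
move=> z fz; have [rs [urs fE _]] := irredp_split C firr fm.
have mf : mup z (ratr_poly f) = 1%N.
  rewrite fE mu_prod_XsubC count_uniq_mem // -root_prod_XsubC -fE fz //.
have f0 : map_poly (@ratr C) f != 0 by rewrite map_poly_eq0 monic_neq0.
have := congr1 (mup z) chi; rewrite mupM ?monic_neq0 ?char_poly_monic //.
have <- : map_poly (@ratr C) (f ^+ N) = char_poly CC by rewrite -charE map_char_poly rat_int.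
by rewrite rmorphXn /= mupX // mf muln1 => ->; rewrite leq_addr.
Qed.

End LowerBound.

(** * Real intertwiners *)

Section MxVec.
Variable K : comNzRingType.

(** This puts the genericity conditions, which are pairings of vectors, into the trace form that
    [generic_mx] handles. *)
Lemma mxvec_dotE m n (a b : 'M[K]_(m, n)) :
  mxvec a *m (mxvec b)^T = (\tr (a *m b^T))%:M.
Proof.
rewrite [LHS]mx11_scalar mxE (reindex _ (curry_mxvec_bij _ _)) /=; congr (_%:M).
under [RHS]eq_bigr do rewrite mxE.
rewrite pair_bigA; apply: eq_bigr => -[i j] _ /=.
by rewrite [(mxvec b)^T _ _]mxE !mxvecE [b^T _ _]mxE.
Qed.

Lemma mxvec_mul_lin_mulmxr m n p (a : 'M[K]_(m, n)) (F : 'M_(n, p)) :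
  mxvec a *m lin_mulmxr F = mxvec (a *m F).
Proof. exact: mul_vec_lin. Qed.

Lemma mxvec_mul_lin_mulmx m n p (G : 'M[K]_(m, n)) (a : 'M_(n, p)) :
  mxvec a *m lin_mulmx G = mxvec (G *m a).
Proof. exact: mul_vec_lin. Qed.

Lemma row_mul_matrixP m n (A B : 'M[K]_(m, n)) :
  (forall u : 'rV_m, u *m A = u *m B) -> A = B.
Proof. by move=> H; apply/row_matrixP => i; rewrite !rowE H. Qed.

Lemma lin_mulmxr_mul m n p q (F : 'M[K]_(n, p)) (G : 'M_(p, q)) :
  lin_mulmxr F *m lin_mulmxr G = lin_mulmxr (F *m G) :> 'M_(m * n, m * q).
Proof.
apply: row_mul_matrixP => u; rewrite -[u]vec_mxK mulmxA.
by rewrite !mxvec_mul_lin_mulmxr mulmxA.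
Qed.

(** The order is reversed because operators act on row vectors from the right. *)
Lemma lin_mulmx_mul m n p q (F : 'M[K]_(m, n)) (G : 'M_(n, p)) :
  lin_mulmx G *m lin_mulmx F = lin_mulmx (F *m G) :> 'M_(p * q, m * q).
Proof.
apply: row_mul_matrixP => u; rewrite -[u]vec_mxK mulmxA.
by rewrite !mxvec_mul_lin_mulmx mulmxA.
Qed.

Lemma lin_mulmx1 m n : lin_mulmx (1%:M : 'M[K]_m) = 1%:M :> 'M_(m * n).
Proof.
apply: row_mul_matrixP => u; rewrite -[u]vec_mxK mxvec_mul_lin_mulmx.
by rewrite mul1mx mulmx1.
Qed.

Lemma lin_mulmxr1 m n : lin_mulmxr (1%:M : 'M[K]_n) = 1%:M :> 'M_(m * n).
Proof.
apply: row_mul_matrixP => u; rewrite -[u]vec_mxK mxvec_mul_lin_mulmxr.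
by rewrite !mulmx1.
Qed.

Lemma lin_mulmx_mulmxr_comm m n p q (G : 'M[K]_(m, n)) (F : 'M_(p, q)) :
  lin_mulmx G *m lin_mulmxr F = lin_mulmxr F *m lin_mulmx G.
Proof.
apply: row_mul_matrixP => u; rewrite -[u]vec_mxK !mulmxA.
by rewrite !(mxvec_mul_lin_mulmx, mxvec_mul_lin_mulmxr) mulmxA.
Qed.

Lemma trmx_lin_mulmxr m n p (F : 'M[K]_(n, p)) :
  (lin_mulmxr F)^T = lin_mulmxr F^T :> 'M_(m * p, m * n).
Proof.
apply: row_mul_matrixP => u; apply: trmx_inj; apply: row_mul_matrixP => v.
rewrite trmx_mul trmxK mulmxA -[u]vec_mxK -[v]vec_mxK !mxvec_mul_lin_mulmxr.
by rewrite !mxvec_dotE trmx_mul trmxK mulmxA.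
Qed.

End MxVec.

Lemma map_lin_mulmxr (aR rR : comNzRingType) (h : {rmorphism aR -> rR}) m n p
    (F : 'M[aR]_(n, p)) :
  map_mx h (lin_mulmxr F) = lin_mulmxr (map_mx h F) :> 'M_(m * n, m * p).
Proof. by apply: map_lin_mx => A; rewrite /= map_mxM. Qed.

Lemma map_lin_mulmx (aR rR : comNzRingType) (h : {rmorphism aR -> rR}) m n p
    (F : 'M[aR]_(m, n)) :
  map_mx h (lin_mulmx F) = lin_mulmx (map_mx h F) :> 'M_(n * p, m * p).
Proof. by apply: map_lin_mx => A; rewrite /= map_mxM. Qed.

Lemma char_poly_tr (K : comNzRingType) n (A : 'M[K]_n) : char_poly A^T = char_poly A.
Proof.
by rewrite /char_poly -det_tr /char_poly_mx linearB /= tr_scalar_mx map_trmx trmxK.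
Qed.

Lemma eigenvector_exists (F : closedFieldType) n (A : 'M[F]_n) : (0 < n)%N ->
  exists b (v : 'rV_n), v != 0 /\ v *m A = b *: v.
Proof.
move=> n0; have /closed_rootP[b] : size (char_poly A) != 1%N.
  by rewrite size_char_poly; case: n n0 A.
by rewrite -eigenvalue_root_char => /eigenvalueP[v vA v0]; exists b, v.
Qed.

(** The vector case applies to a nonzero row of [x] and a nonzero column of [q]. *)
Lemma irredp_eigenmx_mul_neq0 (K C : fieldType) (iota : {rmorphism K -> C})
    d (F : 'M[K]_d) N N' (x : 'M[C]_(N, d)) b (q : 'M[K]_(d, N')) :
  irreducible_poly (char_poly F) -> x *m map_mx iota F = b *: x -> x != 0 ->
  q != 0 -> x *m map_mx iota q != 0.
Proof.
move=> firr xF x0 q0; apply/eqP => xq.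
have [i xi] : exists i, row i x != 0.
  apply/existsP; apply: contra_neqT x0 => /existsPn H.
  by apply/row_matrixP => i; rewrite row0; apply/eqP; have := H i; rewrite negbK.
have [j qj] : exists j, col j q != 0.
  apply/existsP; apply: contra_neqT q0 => /existsPn H.
  by apply/matrixP => a j; have := H j; rewrite negbK => /eqP/colP/(_ a); rewrite !mxE.
have rF : row i x *m map_mx iota F = b *: row i x by rewrite -row_mul xF linearZ.
have /eqP := irredp_eigenvector_neq0 firr rF xi qj; apply.
by rewrite map_col colE mulmxA -row_mul xq row0 mul0mx.
Qed.

(** * Descent of intertwiners from complex to real matrices *)

Section RealDescent.
Variable R : realType.
Local Notation C := (complex R).
Local Notation cx := (map_mx (real_complex R)).

(** [A] and [Cm] are real, so the real and imaginary parts [U] and [V] of [X] intertwine separately.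
    The polynomial [det ((U + t V) Z)] is nonzero at the imaginary unit, hence at some real [t]. *)
Lemma real_intertwiner_half n s (A : 'M[R]_n) (Cm : 'M[R]_s)
    (X : 'M[C]_(n, s)) (Z : 'M[C]_(s, n)) :
  X *m cx Cm = cx A *m X -> X *m Z \in unitmx ->
  exists2 X' : 'M[R]_(n, s), X' *m Cm = A *m X' & cx X' *m Z \in unitmx.
Proof.
move=> XC XZ.
pose U : 'M[R]_(n, s) := map_mx (@complex.Re R) X.
pose V : 'M[R]_(n, s) := map_mx (@complex.Im R) X.
have XE : X = cx U + 'i%C *: cx V.
  by apply/matrixP => i j; rewrite !mxE -complexE.
have [UC VC] : U *m Cm = A *m U /\ V *m Cm = A *m V.
  move: XC; rewrite XE mulmxDl mulmxDr -scalemxAl -scalemxAr -!map_mxM => /matrixP H.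
  by split; apply/matrixP => i j; have := H i j; rewrite !mxE; simpc; case.
pose p : {poly C} := \det (map_mx polyC (cx U *m Z) + 'X *: map_mx polyC (cx V *m Z)).
have pE t : p.[t] = \det ((cx U + t *: cx V) *m Z).
  rewrite -/(horner_eval t p) -det_map_mx; congr (\det _).
  rewrite map_mxD map_mxZ /= /horner_eval hornerX mulmxDl -scalemxAl.
  by congr (_ + _ *: _); apply/matrixP => i j; rewrite !mxE hornerC.
have p0 : p != 0.
  apply: contraTneq XZ => p0; rewrite unitmxE XE -pE p0 horner0 unitr0 //.
have [t tP] := @avoid_roots R unit (fun _ => p) (fun _ => p0).
exists (U + t *: V); first by rewrite mulmxDl mulmxDr -scalemxAl -scalemxAr UC VC.
by rewrite unitmxE unitfE map_mxD map_mxZ -pE; apply: (tP tt).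
Qed.

(** The half step makes [X] real and, applied to transposes, [Z] as well. Their product [W] commutes
    with [A], so dividing by it restores the normalisation and keeps the intertwining. *)
Lemma real_intertwiner n s (A : 'M[R]_n) (Cm : 'M[R]_s)
    (X : 'M[C]_(n, s)) (Z : 'M[C]_(s, n)) :
  X *m cx Cm = cx A *m X -> cx Cm *m Z = Z *m cx A -> X *m Z = 1%:M ->
  exists (X' : 'M[R]_(n, s)) (Z' : 'M[R]_(s, n)),
  [/\ X' *m Cm = A *m X', Cm *m Z' = Z' *m A & X' *m Z' = 1%:M].
Proof.
move=> XC CZ XZ.
have [|X1 X1C X1Z] := real_intertwiner_half XC (Z := Z); first by rewrite XZ unitmx1.
have [||Z1t Z1C Z1X] := @real_intertwiner_half n s A^T Cm^T Z^T (cx X1)^T.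
- by rewrite -!map_trmx -!trmx_mul CZ.
- by rewrite -trmx_mul unitmx_tr.
pose W := X1 *m Z1t^T.
have Wu : W \in unitmx.
  by move: Z1X; rewrite map_trmx -map_mxM map_unitmx -unitmx_tr trmx_mul trmxK.
have CZ1 : Cm *m Z1t^T = Z1t^T *m A by apply: trmx_inj; rewrite !trmx_mul trmxK.
exists X1, (Z1t^T *m invmx W); split=> //; last by rewrite mulmxA mulmxV.
rewrite mulmxA CZ1 -!mulmxA; congr (_ *m _).
have AW : A *m W = W *m A by rewrite /W mulmxA -X1C -!mulmxA CZ1.
by rewrite -[LHS](mulKmx Wu) (mulmxA W) -AW mulmxK.
Qed.

(** [Y] is a basis of the row kernel of [Z], which is stable because [Cm Z = Z A], has dimension [k]
    because [Z] has rank [n], and meets the row span of [X] trivially because [X Z = 1]. *)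
Lemma invariant_complement n k s (A : 'M[R]_n) (Cm : 'M[R]_s)
    (X : 'M[R]_(n, s)) (Z : 'M[R]_(s, n)) :
  (n + k)%N = s -> X *m Cm = A *m X -> Cm *m Z = Z *m A -> X *m Z = 1%:M ->
  exists (Y : 'M[R]_(k, s)) (B : 'M[R]_k),
  [/\ Y *m Cm = B *m Y, Y *m Z = 0 & row_free (col_mx X Y)].
Proof.
move=> nks XC CZ XZ.
have rZ : \rank Z = n.
  apply/eqP; rewrite eqn_leq rank_leq_col -[X in (X <= _)%N](mxrank1 R n) -XZ.
  exact: mxrankM_maxr.
have rk : \rank (kermx Z) = k by rewrite mxrank_ker rZ -nks addKn.
have [Y [YZ Yf]] : exists Y : 'M[R]_(k, s), (Y :=: kermx Z)%MS /\ row_free Y.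
  case: _ / rk; exists (row_base (kermx Z)).
  by split; [exact: eq_row_base|exact: row_base_free].
have YZ0 : Y *m Z = 0 by apply/sub_kermxP; rewrite -YZ.
exists Y, (Y *m Cm *m pinvmx Y); split=> //.
  rewrite mulmxKpV // YZ; apply/sub_kermxP.
  by rewrite -mulmxA CZ mulmxA YZ0 mul0mx.
apply: inj_row_free => v; rewrite -[v]hsubmxK mul_row_col => e.
have l0 : lsubmx v = 0.
  have := congr1 (mulmx^~ Z) e; rewrite mulmxDl -!mulmxA XZ YZ0 mulmx0 addr0 mulmx1.
  by rewrite mul0mx.
move: e; rewrite l0 mul0mx add0r => e; suff -> : rsubmx v = 0 by rewrite row_mx0.
by apply/eqP; rewrite -(mulmx_free_eq0 _ Yf) e.
Qed.

End RealDescent.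

(** [c i] counts the smaller indices in the fibre of [i]. Colliding pairs lie in one fibre of [e],
    on which this count is strictly increasing. *)
Lemma inj_pair_of_fibers n N (T J : eqType) (e : 'I_n -> T) (j : 'I_n -> J) :
  (forall i, #|[set i' | e i' == e i]| <= N)%N ->
  (forall i i', j i = j i' -> e i = e i') ->
  exists c : 'I_n -> 'I_N, injective (fun i => (c i, j i)).
Proof.
move=> le ej; pose S (i : 'I_n) := [set i' : 'I_n | (i' < i)%N & e i' == e i].
have ltS (i : 'I_n) : (#|S i| < N)%N.
  apply: leq_trans (le i); apply: proper_card; apply/properP; split.
    by apply/subsetP => x; rewrite !inE => /andP[].
  by exists i; rewrite !inE ?eqxx ?ltnn.
exists (fun i => Ordinal (ltS i)) => a b [cab jab].
have eab := ej _ _ jab.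
wlog lt_ab : a b cab jab eab / (a < b)%N.
  move=> H; case: (ltngtP a b) => [|ba|/val_inj //]; first exact: H.
  by apply/esym/H.
suff : (#|S a| < #|S b|)%N by rewrite cab ltnn.
apply: proper_card; apply/properP; split.
  by apply/subsetP => x; rewrite !inE eab => /andP[xa ->]; rewrite (ltn_trans xa).
by exists a; rewrite !inE ?lt_ab ?eab ?eqxx ?ltnn.
Qed.

Lemma diagonalizable_of_split (F : fieldType) d (A : 'M[F]_d) rs :
  uniq rs -> char_poly A = \prod_(z <- rs) ('X - z%:P) -> diagonalizable A.
Proof.
case: d A => [|d] A urs e; first by rewrite [A]flatmx0; apply: diagonalizable0.
by apply/diagonalizableP; exists rs => //; rewrite -e mxminpoly_dvd_char.
Qed.

Lemma mulmx_mxsub_inj (F : fieldType) n s (c : 'I_n -> 'I_s) (U V : 'M[F]_s) :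
  injective c -> U *m V = 1%:M -> rowsub c U *m colsub c V = 1%:M.
Proof.
move=> ic UV; rewrite mul_rowsub_mx mulmx_colsub UV.
by apply/matrixP => i j; rewrite !mxE (inj_eq ic).
Qed.

(* X sends the i-th eigenvector of A to an eigenvector of F in the c(i)-th summand
   of (K^d)^N, where c separates the indices sharing an eigenvalue. *)
Lemma split_intertwiner (K : fieldType) n d N (A Q : 'M[K]_n) (e : 'rV_n)
    (F T : 'M[K]_d) (b : 'rV_d) :
  Q \in unitmx -> Q *m A = diag_mx e *m Q ->
  T \in unitmx -> T *m F = diag_mx b *m T ->
  (forall i, exists j, b 0 j = e 0 i) ->
  (forall z, mup z (char_poly A) <= N)%N ->
  exists (X : 'M[K]_(n, N * d)) (Z : 'M[K]_(N * d, n)),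
    [/\ X *m lin_mulmxr F = A *m X, lin_mulmxr F *m Z = Z *m A & X *m Z = 1%:M].
Proof.
move=> Qu QA Tu TF /fin_all_exists[j je] le.
have [c ic] : exists c : 'I_n -> 'I_N, injective (fun i => (c i, j i)).
  apply: (@inj_pair_of_fibers n N _ _ (fun i => e 0 i)) => [i|i i']; last by rewrite -!je => ->.
  apply: leq_trans (le (e 0 i)).
  rewrite (char_poly_diagonalizable Qu QA) mu_prod_XsubC count_map.
  rewrite -sum1_count big_enum_cond /= sum1_card; apply: subset_leq_card.
  by apply/subsetP => x; rewrite !inE.
pose si i := mxvec_index (c i) (j i).
have isi : injective si.
  have [h hK _] := curry_mxvec_bij N d; move=> x y sxy; apply: ic.
  pose u := uncurry (@mxvec_index N d).
  have := congr1 h (sxy : u (c x, j x) = u (c y, j y)).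
  by rewrite !hK.
(* [T] diagonalises the action of [F]: the row of [U] at position [(c, j)] is an eigenvector with
   eigenvalue [b 0 j]. *)
pose U : 'M[K]_(N * d) := lin_mulmxr T; pose V : 'M[K]_(N * d) := lin_mulmxr (invmx T).
have UV : U *m V = 1%:M by rewrite lin_mulmxr_mul mulmxV // lin_mulmxr1.
pose D : 'M[K]_(N * d) := lin_mulmxr (diag_mx b).
have UF : U *m lin_mulmxr F = D *m U by rewrite !lin_mulmxr_mul TF.
have FV : lin_mulmxr F *m V = V *m D.
  rewrite !lin_mulmxr_mul; congr lin_mulmxr.
  by rewrite -[LHS](mulKmx Tu) (mulmxA T) TF mulmxK.
have Drow i : row (si i) D = e 0 i *: row (si i) 1%:M.
  rewrite !rowE /D /si; set dl := delta_mx _ _.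
  have -> : dl = mxvec (delta_mx (c i) (j i)) by rewrite -vec_mx_delta vec_mxK.
  rewrite mxvec_mul_lin_mulmxr mulmx1 -linearZ; congr mxvec.
  rewrite -je; apply/matrixP => x y; rewrite mul_mx_diag !mxE.
  by case: eqP; case: eqP => //= [->|]; rewrite ?mulr0 ?mul0r ?mulr1 ?mul1r.
have DT : D^T = D by rewrite trmx_lin_mulmxr tr_diag_mx.
(* The selected rows of [U] carry the eigenvalues of [A] in the order of [e], and [Q] translates
   between this eigenbasis and [A]. *)
exists (invmx Q *m rowsub si U), (colsub si V *m Q); split.
- rewrite -mulmxA mul_rowsub_mx UF.
  have -> : rowsub si (D *m U) = diag_mx e *m rowsub si U.
    apply/row_matrixP => i; rewrite row_rowsub row_mul Drow -scalemxAl -row_mul mul1mx.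
    by rewrite row_mul row_diag_mx -scalemxAl -rowE row_rowsub.
  by rewrite !mulmxA; congr (_ *m _); rewrite -[RHS](mulKmx Qu) (mulmxA Q) QA mulmxK.
- rewrite mulmxA mulmx_colsub FV.
  have -> : colsub si (V *m D) = colsub si V *m diag_mx e.
    apply: trmx_inj; rewrite trmx_mul !trmx_mxsub tr_diag_mx trmx_mul DT.
    apply/row_matrixP => i; rewrite row_rowsub row_mul Drow -scalemxAl -row_mul mul1mx.
    by rewrite row_mul row_diag_mx -scalemxAl -rowE row_rowsub.
  by rewrite -!mulmxA QA.
- rewrite mulmxA -(mulmxA (invmx Q)) mulmx_mxsub_inj // mulmx1 mulVmx //.
Qed.

(** * Genericity in terms of the rows of the lattice matrix *)

Section Assembly.
Variable R : realType.
Local Notation C := (complex R).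
Local Notation cx := (map_mx (real_complex R)).

(** The last three hypotheses yield non-degeneracy, aperiodicity and, through [kronecker] for the
    transpose of [Y], density. *)
Lemma generic_cps_of_rows n k s (A : 'M[R]_n) (B : 'M[R]_k)
    (X : 'M[R]_(n, s)) (Y : 'M[R]_(k, s)) (Cm : 'M[int]_s) :
  (n + k)%N = s -> (0 < n)%N -> (0 < k)%N -> row_free (col_mx X Y) ->
  X *m zmx Cm = A *m X -> Y *m zmx Cm = B *m Y ->
  (forall r : 'cV[int]_s, X *m zmx r = 0 -> r = 0) ->
  (forall r : 'cV[int]_s, Y *m zmx r = 0 -> r = 0) ->
  (forall (phi : 'rV[R]_k) (z : 'rV[int]_s), phi *m Y = zmx z -> phi = 0) ->
  exists L : 'M[R]_(n + k), generic_cps_with_selfsim A L.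
Proof.
move=> nks; case: _ / nks X Y Cm => X Y Cm n0 k0 fr XC YC nX nY irr.
exists (col_mx X Y).
have inj (W : 'M[R]_(_, n + k)) :
    (forall r : 'cV[int]_(n + k), W *m zmx r = 0 -> r = 0) ->
    forall r r' : 'cV[int]_(n + k), W *m zmx r = W *m zmx r' -> r = r'.
  move=> H r r' e; apply/eqP; rewrite -subr_eq0; apply/eqP/H.
  by rewrite map_mxB mulmxBr e subrr.
split; split.
- split=> //; first by rewrite -row_free_unit.
    move=> _ _ [r ->] [r' ->]; rewrite /pi_par !mul_col_mx !col_mxKu.
    by move=> /(inj _ _ nX) ->.
  move=> _ _ [r ->] [r' ->]; rewrite /pi_perp !mul_col_mx !col_mxKd.
  by move=> /(inj _ _ nY) ->.
- move=> y e e0.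
  (* The case [z = 0] of [irr] says that the rows of [Y] are independent. *)
  have fY : row_full Y^T.
    rewrite /row_full mxrank_tr -/(row_free Y); apply: inj_row_free => v vY.
    by apply: (irr v 0); rewrite vY map_mx0.
  have [phi [z e1]|g gP] := kronecker fY _ y^T e0.
    apply: trmx_inj; rewrite trmx0; apply: (irr _ z^T).
    by apply: trmx_inj; rewrite trmx_mul trmxK e1 map_trmx trmxK.
  exists (col_mx X Y *m zmx g^T); split; first by exists g^T.
  have gY : Y *m zmx g^T = (zmx g *m Y^T)^T by rewrite trmx_mul trmxK map_trmx.
  move=> i; have := gP 0 i; rewrite /pi_perp mul_col_mx col_mxKd gY distrC.
  by rewrite !mxE.
- move=> _ [r ->]; exists (col_mx X Y *m zmx (Cm *m r)); split; first by exists (Cm *m r).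
  rewrite /pi_par !mul_col_mx !col_mxKu map_mxM !mulmxA XC //.
- exists Cm, B; rewrite mul_block_col !mul0mx addr0 add0r mul_col_mx XC YC //.
Qed.

End Assembly.

(** * Existence of a generic scheme *)

Section Existence.
Variable R : realType.
Local Notation C := (complex R).
Local Notation cx := (map_mx (real_complex R)).

Lemma cx_intr m n (M : 'M[int]_(m, n)) : cx (zmx M) = zmx M.
Proof. by apply/matrixP => i j; rewrite !mxE rmorph_int. Qed.

Lemma ratr_intr m n (M : 'M[int]_(m, n)) :
  map_mx ratr (zmx M : 'M[rat]_(m, n)) = zmx M :> 'M[C]_(m, n).
Proof. by apply/matrixP => i j; rewrite !mxE ratr_int. Qed.

Lemma zmx_eq0 (K : numDomainType) m n (M : 'M[int]_(m, n)) :
  (zmx M == 0 :> 'M[K]_(m, n)) = (M == 0).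
Proof.
apply/eqP/eqP => [/matrixP H|->]; last by rewrite map_mx0.
by apply/matrixP => i j; have := H i j; rewrite !mxE => /eqP; rewrite intr_eq0 => /eqP.
Qed.

Lemma int_eigenmx_mul_neq0 d N N' (F : 'M[int]_d) (x : 'M[C]_(N, d)) b
    (q : 'M[int]_(d, N')) :
  irreducible_poly (char_poly (zmx F : 'M[rat]_d)) -> x *m zmx F = b *: x -> x != 0 ->
  q != 0 -> x *m zmx q != 0.
Proof.
move=> firr xF x0 q0; rewrite -ratr_intr.
by apply: (irredp_eigenmx_mul_neq0 (b := b) firr); rewrite ?ratr_intr ?zmx_eq0.
Qed.

Section Pairing.
Variables (N d : nat) (F : 'M[int]_d).
Hypothesis firr : irreducible_poly (char_poly (zmx F : 'M[rat]_d)).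
Let Cm : 'M[int]_(N * d) := lin_mulmxr F.

(** [X] pulls a complex eigenvector [w] of [A] back to one of the lattice action, that is, to a
    matrix [x] with [x F = b x]; irreducibility keeps its products with nonzero integer matrices
    nonzero. *)
Lemma int_lattice_eigenvector m (A : 'M[R]_m) (X : 'M[R]_(m, N * d)) :
  (0 < m)%N -> row_free X -> X *m zmx Cm = A *m X ->
  exists x : 'M[C]_(N, d), [/\
    forall q : 'M[int]_(d, N), q != 0 -> x *m zmx q != 0 &
    exists2 w, mxvec x = w *m cx X & x != 0].
Proof.
move=> m0 fX XC; have [b [w [w0 wA]]] := eigenvector_exists (cx A) m0.
have fcX : row_free (cx X) by rewrite /row_free mxrank_map.
exists (vec_mx (w *m cx X)).
have x0 : vec_mx (w *m cx X) != 0.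
  by rewrite -(inj_eq (can_inj mxvecK)) vec_mxK linear0 mulmx_free_eq0.
split; last by exists w; rewrite ?vec_mxK.
move=> q q0; apply: (int_eigenmx_mul_neq0 (b := b) firr) => //.
apply: (can_inj mxvecK); rewrite -mxvec_mul_lin_mulmxr linearZ /= vec_mxK.
have := congr1 cx XC; rewrite !map_mxM cx_intr /Cm (map_lin_mulmxr intr) => XC'.
by rewrite -mulmxA XC' mulmxA wA scalemxAl.
Qed.

End Pairing.

Theorem generic_scheme_exists n k N (A : 'M[R]_n) (f : {poly rat}) (g : {poly int}) :
  (0 < n)%N -> (0 < k)%N -> f \is monic -> irreducible_poly f ->
  g \is monic -> f = map_poly intr g ->
  diagonalizable (cmx A) ->
  (forall z, eigenvalue (cmx A) z -> root (ratr_poly f) z) ->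
  (forall z, (alg_mult A z <= N)%N) ->
  (n + k = N * (size f).-1)%N ->
  exists L : 'M[R]_(n + k), generic_cps_with_selfsim A L.
Proof.
move=> n0 k0 fm firr gm fg /diagonalizableE[Q [e [Qu QA]]] ev multN nk.
have sfg : size f = size g by rewrite fg size_rat_int_poly.
rewrite sfg in nk; set d := (size g).-1 in nk.
pose F : 'M[int]_d := companionmx g.
have charF : char_poly (zmx F : 'M[rat]_d) = f.
  by rewrite -map_char_poly companionmxK.
have charFC : char_poly (zmx F : 'M[C]_d) = ratr_poly f.
  by rewrite -charF map_char_poly ratr_intr.
have Firr : irreducible_poly (char_poly (zmx F : 'M[rat]_d)) by rewrite charF.
have [rs [urs rsE _]] := irredp_split C firr fm.
have [T [b [Tu TF]]] := diagonalizableE (diagonalizable_of_split urs (etrans charFC rsE)).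
have rootb z : root (ratr_poly f) z -> exists j, b 0 j = z.
  rewrite -charFC (char_poly_diagonalizable Tu TF) root_prod_XsubC => /mapP[j _ ->].
  by exists j.
have roote i : root (ratr_poly f) (e 0 i).
  apply: ev; rewrite eigenvalue_root_char (char_poly_diagonalizable Qu QA).
  by rewrite root_prod_XsubC; apply: map_f; rewrite mem_enum.
have [Xc [Zc [XcC ZcC XcZc]]] :=
  split_intertwiner Qu QA Tu TF (fun i => rootb _ (roote i)) multN.
pose Cm : 'M[int]_(N * d) := lin_mulmxr F.
have CmC : cx (zmx Cm) = lin_mulmxr (zmx F) by rewrite cx_intr (map_lin_mulmxr intr).
rewrite -CmC in XcC ZcC.
have [X [Z [XC CZ XZ]]] := real_intertwiner XcC ZcC XcZc.
have [Y [B [YC YZ fXY]]] := invariant_complement nk XC CZ XZ.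
have fY : row_free Y.
  apply: inj_row_free => v vY; suff : row_mx (0 : 'rV_n) v = 0.
    by move/(congr1 rsubmx); rewrite row_mxKr linear0.
  by apply/eqP; rewrite -(mulmx_free_eq0 _ fXY) mul_row_col mul0mx add0r vY.
have fX : row_free X.
  by apply: inj_row_free => v vX; rewrite -[v]mulmx1 -XZ mulmxA vX mul0mx.
(* One eigenvector from each of [X], [Y] and [Z^T] suffices: an integer vector violating
   non-degeneracy, aperiodicity or density would be orthogonal to it after the twist. *)
have [xA [PA [wA xAE xA0]]] := int_lattice_eigenvector Firr n0 fX XC.
have [xB [PB [wB xBE xB0]]] := int_lattice_eigenvector Firr k0 fY YC.
have fZ : row_free Z^T.
  apply: inj_row_free => v vZ; apply: trmx_inj; rewrite -[v^T]mul1mx -XZ -mulmxA.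
  by rewrite -[Z *m v^T]trmxK trmx_mul trmxK vZ !trmx0 mulmx0.
have FTirr : irreducible_poly (char_poly (zmx F^T : 'M[rat]_d)).
  by rewrite -map_trmx char_poly_tr.
have ZC : Z^T *m zmx (lin_mulmxr F^T : 'M_(N * d)) = A^T *m Z^T.
  by rewrite -trmx_lin_mulmxr -map_trmx -!trmx_mul CZ.
have [xZ [PZ [wZ xZE xZ0]]] := int_lattice_eigenvector FTirr n0 fZ ZC.
pose I := {r : 'M[int]_(N, d) | r != 0}.
have trN (r : I) : (sval r)^T != 0 by rewrite trmx_eq0; apply: svalP r.
(* The family for [G] encodes non-degeneracy ([xA]) and aperiodicity ([xB]), the one for [H] density
   ([xZ]). *)
have [||G [H [GH GP HP]]] := @generic_mx R N (I + I)%type I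
  (fun r => match r with inl r => xA *m zmx (sval r)^T | inr r => xB *m zmx (sval r)^T end)
  (fun r => zmx (sval r) *m xZ^T).
- by case=> r; [apply: PA|apply: PB].
- move=> r; rewrite -trmx_eq0 trmx_mul trmxK map_trmx; exact: PZ.
pose Gt : 'M[R]_(N * d) := lin_mulmx G; pose Ht : 'M[R]_(N * d) := lin_mulmx H.
have GHt : Gt *m Ht = 1%:M by rewrite lin_mulmx_mul (mulmx1C GH) lin_mulmx1.
have Gtu : Gt \in unitmx by case/mulmx1_unit: GHt.
have GtC : Gt *m zmx Cm = zmx Cm *m Gt.
  by rewrite /Cm (map_lin_mulmxr intr) lin_mulmx_mulmxr_comm.
have nondeg m (W : 'M[R]_(m, N * d)) x w : mxvec x = w *m cx W ->
    (forall r : I, \tr (cmx G *m (x *m zmx (sval r)^T)) != 0) ->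
    forall r : 'cV[int]_(N * d), W *m Gt *m zmx r = 0 -> r = 0.
  move=> xE tr0 r Wr; pose rho := vec_mx r^T; apply/eqP; apply: contraT => r0.
  have rho0 : rho != 0.
    by rewrite -(inj_eq (can_inj mxvecK)) vec_mxK linear0 trmx_eq0.
  have /eqP[] := tr0 (exist _ rho rho0).
  have : mxvec (cmx G *m x) *m (mxvec (zmx rho : 'M[C]_(N, d)))^T = 0.
    rewrite -mxvec_mul_lin_mulmx xE -map_mxvec vec_mxK -map_trmx trmxK.
    rewrite -(map_lin_mulmx (real_complex R)) -cx_intr -!mulmxA -!map_mxM !mulmxA.
    by rewrite Wr map_mx0 mulmx0.
  by rewrite mxvec_dotE map_trmx mulmxA => /matrixP/(_ 0 0); rewrite !mxE.
apply: (@generic_cps_of_rows R n k (N * d) A B (X *m Gt) (Y *m Gt) Cm) => //.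
- rewrite -mul_col_mx; apply: inj_row_free => v; rewrite mulmxA => /eqP.
  by rewrite (mulmx_free_eq0 _ (_ : row_free Gt)) ?row_free_unit // mulmx_free_eq0 // => /eqP.
- by rewrite -mulmxA GtC !mulmxA XC.
- by rewrite -mulmxA GtC !mulmxA YC.
- by apply: nondeg xAE _ => r; apply: (GP (inl r)).
- by apply: nondeg xBE _ => r; apply: (GP (inr r)).
(* From [z = phi Y Gt], [Gt Ht = 1] and [Y Z = 0] follows [z Ht Z = 0], so that
   [tr (H zeta xZ^T) = 0]. *)
move=> phi z zE; apply/eqP; apply: contraT => phi0.
pose zeta := vec_mx z.
have zeta0 : zeta != 0.
  rewrite -(inj_eq (can_inj mxvecK)) vec_mxK linear0 -(zmx_eq0 R) -zE mulmxA.
  by rewrite !mulmx_free_eq0 ?row_free_unit.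
have /eqP[] := HP (exist _ zeta zeta0).
have : mxvec (cmx H *m zmx zeta) *m (mxvec xZ)^T = 0.
  rewrite -mxvec_mul_lin_mulmx xZE -map_mxvec vec_mxK trmx_mul -map_trmx trmxK.
  rewrite -(map_lin_mulmx (real_complex R)) -cx_intr -zE mulmxA -!map_mxM -/Ht.
  by rewrite -!mulmxA GHt mulmx1 mulmxA -map_mxM -mulmxA YZ mulmx0 map_mx0 mul0mx.
by rewrite mxvec_dotE mulmxA => /matrixP/(_ 0 0); rewrite !mxE.
Qed.

End Existence.

(** * The minimal dimension *)

Theorem theorem3 (R : realType) (n : nat) (A : 'M[R]_n)
  (f : {poly rat}) (M m : nat) :
  (0 < n)%N ->
  diagonalizable (cmx A) ->
  (forall l : complex R, eigenvalue (cmx A) l ->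
      algebraic_integer l /\ minpoly_Q f l) ->
  (* M = max, m = min of m_A(beta) over the roots beta of f *)
  (exists2 b : complex R, root (map_poly (fun q : rat => ratr q) f) b & alg_mult A b = M) ->
  (forall b : complex R, root (map_poly (fun q : rat => ratr q) f) b -> (alg_mult A b <= M)%N) ->
  (exists2 b : complex R, root (map_poly (fun q : rat => ratr q) f) b & alg_mult A b = m) ->
  (forall b : complex R, root (map_poly (fun q : rat => ratr q) f) b -> (m <= alg_mult A b)%N) ->
  forall (k : nat) (L : 'M[R]_(n + k)),
    generic_cps_with_selfsim A L ->
    (forall (k' : nat) (L' : 'M[R]_(n + k')), (k' < k)%N -> ~ generic_cps_with_selfsim A L') ->
    (n + k = if (m < M)%N then M * (size f).-1 else M.+1 * (size f).-1)%N.
Proof.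
move=> n0 diagA evA [b1 rb1 mb1] leM [b2 rb2 mb2] gem k L [[[_ k0 Lu nd _] _] ss] Lmin.
have [l [v [v0 vA]]] := eigenvector_exists (cmx A) n0.
have [[p [pm pl]] [fm fl fmin]] := evA l (introT eigenvalueP (ex_intro2 _ _ v vA v0)).
have firr := min_size_root_irreducible fm fl fmin.
have [g gm fg] := monic_int_of_algebraic_integer firr fm fl pm pl.
have ev z : eigenvalue (cmx A) z -> root (ratr_poly f) z by move=> /evA[_ []].
have [rs [urs rsE srs]] := irredp_split (complex R) firr fm.
have in_rs z : (z \in rs) = root (ratr_poly f) z by rewrite rsE root_prod_XsubC.
have nE : n = (\sum_(z <- rs) alg_mult A z)%N.
  have [Q [e [Qu QA]]] := diagonalizableE diagA.
  have chA := char_poly_diagonalizable Qu QA.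
  have se : size [seq e 0 i | i <- enum 'I_n] = n by rewrite size_map size_enum_ord.
  rewrite -[LHS]se (size_sum_count urs) => [|z ze].
    by apply: eq_bigr => z _; rewrite /alg_mult chA mu_prod_XsubC.
  by rewrite in_rs; apply: ev; rewrite eigenvalue_root_char chA root_prod_XsubC.
have [N [nkN leN]] := generic_cps_dim n0 fm firr fg diagA ev Lu nd ss.
set d := (size f).-1 in srs nkN *.
(* The least [N] such that [n < N d] and all multiplicities are at most [N]. *)
pose N0 := if (m < M)%N then M else M.+1.
have -> : (if (m < M)%N then M * d else M.+1 * d)%N = (N0 * d)%N by rewrite /N0; case: ifP.
have M_N0 : (M <= N0)%N by rewrite /N0; case: ifP.
have sumM : (\sum_(z <- rs) M = M * d)%N by rewrite big_const_seq count_predT iter_addn_0 srs.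
have d0 : (0 < d)%N by rewrite -srs; case: (rs) (in_rs b1) => //; rewrite [root _ _]rb1.
have eqM : (M <= m)%N -> n = (M * d)%N.
  move=> Mm; rewrite nE -sumM; apply: eq_big_seq => z; rewrite in_rs => rz.
  by apply/eqP; rewrite eqn_leq leM // (leq_trans Mm) ?gem.
(* For [m < M] the root [b2] alone makes the sum of multiplicities smaller than [M d]; otherwise
   [n = M d]. *)
have n_lt : (n < N0 * d)%N.
  rewrite /N0; case: (ltnP m M) => [mM|Mm]; last by rewrite (eqM Mm) ltn_pmul2r.
  have b2rs : b2 \in rs by rewrite in_rs.
  rewrite nE -sumM (bigD1_seq b2) //= [X in (_ < X)%N](bigD1_seq b2) //= mb2.
  rewrite -addSn leq_add // big_seq_cond [leqRHS]big_seq_cond; apply: leq_sum => z /andP[zrs _].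
  by apply: leM; rewrite -[root _ _]in_rs.
have N0_le : (N0 <= N)%N.
  rewrite /N0; case: (ltnP m M) => [_|Mm]; first by rewrite -mb1 leN.
  by rewrite -(ltn_pmul2r d0) -(eqM Mm) -nkN -[X in (X < _)%N]addn0 ltn_add2l.
have multN z : (alg_mult A z <= N0)%N.
  have [rz|nrz] := boolP (root (ratr_poly f) z); first exact: leq_trans (leM _ rz) M_N0.
  rewrite /alg_mult mupNroot // -eigenvalue_root_char.
  by apply: contra nrz => /ev.
have nk1 : (n + (N0 * d - n) = N0 * d)%N by rewrite subnKC // ltnW.
have k10 : (0 < N0 * d - n)%N by rewrite subn_gt0.
(* This scheme of dimension [N0 * d] competes with [L]: minimality gives the upper bound on [n + k],
   and [N0 <= N] the lower one. *)
have [L1 L1P] := generic_scheme_exists n0 k10 fm firr gm fg diagA ev multN nk1.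
have k_le : (k <= N0 * d - n)%N.
  by rewrite leqNgt; apply/negP => lt_k; apply: (Lmin _ L1 lt_k).
apply/eqP; rewrite eqn_leq {2}nkN leq_mul2r N0_le orbT andbT.
by rewrite -nk1 leq_add2l.
Qed.
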